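(* Let $a>0$ be a constant, let $Q(s)$ be one of the functions $$\pm\frac1s,\qquad \pm\frac{a}{\sin(as)},\qquad \pm\frac{a}{\sinh(as)},$$ where the upper sign is taken for $s>0$ and the lower sign for $s<0$ (with $0<s<\frac{\pi}{a}$, respectively $-\frac{\pi}{a}<s<0$, for the second function), and let $\psi(s,t)$ be a solution of the system $$\psi_s=-\tfrac12Q\sin(2\psi),\qquad \psi_t=\tfrac12(\log Q)_s-\tfrac12Q\cos(2\psi).\qquad(\ast)$$ The first equation of $(\ast)$ implies that either $\psi\equiv0 \bmod \frac{\pi}{2}$, or $\frac{2\psi_s}{\sin(2\psi)}=-Q$. In the first case, the second equation of $(\ast)$ gives $(\log Q)_s=Q$ if $\psi\equiv0$ and $(\log Q)_s=-Q$ if $\psi\equiv\frac{\pi}{2}$, and in both cases $Q$ is a function already in the list above. In the second case, $\tan\psi=e^{-\int Q(s)\,ds}\,y(t)$ for some function $y(t)$; explicitly, with upper signs for $s>0$ and lower signs for $s<0$: (i) for $Q=\pm\frac1s$: $\tan\psi=s^{\mp1}\,y(t)$; (ii) for $Q=\pm\frac{a}{\sin(as)}$: $\tan\psi=\left(\tan\frac{as}{2}\right)^{\mp1}y(t)$; (iii) for $Q=\pm\frac{a}{\sinh(as)}$: $\tan\psi=\left(\tanh\frac{as}{2}\right)^{\mp1}y(t)$. Substituting these into the second equation of $(\ast)$ gives an ordinary differential equation for $y$, which integrates as follows ($\sigma,\eta$ are integration constants): (i) for $Q=\frac1s$, $s>0$: $y_t=-1$, so $y(t)=-(t+\sigma)$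 and $\tan\psi=-\frac{t+\sigma}{s}$; for $Q=-\frac1s$, $s<0$: $y_t=-y^2$, with integral $y(t)=\frac{1}{t+\sigma}$ and $\tan\psi=\frac{s}{t+\sigma}$; (ii) for $Q=\frac{a}{\sin(as)}$, $0<s<\frac{\pi}{a}$: $y_t=\frac a2(y^2-1)$, with integral $y(t)=-\tanh\left(\frac{at}{2}+\eta\right)$ and $\tan\psi=\tanh\left(\frac{at}{2}+\eta\right)\tan\left(\frac{as+\pi}{2}\right)$; (iii) for $Q=\frac{a}{\sinh(as)}$, $s>0$: $y_t=-\frac a2(1+y^2)$, with integral $y(t)=-\tan\left(\frac{at}{2}+\eta\right)$ and, after renaming the integration constant ($\eta$ replaced by $\eta-\frac{\pi}{2}$), $\tan\psi=\cot\left(\frac{at}{2}+\eta\right)\coth\left(\frac{as}{2}\right)$.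
   Context: Subscripts $s,t$ denote partial derivatives with respect to the real variables $s,t$. With the sign conventions stated, $Q$ is positive on its domain, so $\log Q$ is defined. $\int Q(s)\,ds$ denotes an antiderivative of $Q$; constant factors are absorbed into $y(t)$.
   Formalization: The alternative from the first equation is stated for each fixed t, since it can fail uniformly in (s,t); in (ii) the integral y = -tanh(at/2+η) is one of four alternatives, the others being y = 1, y = -1 and y = -coth(at/2+η), which also arise from solutions ψ. *)

(* Defs.v *)
From Stdlib Require Import Reals ZArith.
From Coquelicot Require Import Coquelicot.
Open Scope R_scope.

(* The three families of [Q], and the choice of sign in the double symbols:
   [Upper] means s > 0 and [Lower] means s < 0. *)
Inductive Qfamily := Rational | Trigonometric | Hyperbolic.
Inductive branch := Upper | Lower.

Definition sgn (e : branch) : Z :=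
  match e with Upper => 1%Z | Lower => (-1)%Z end.

Definition Q (a : R) (k : Qfamily) (e : branch) (s : R) : R :=
  match k with
  | Rational => IZR (sgn e) * (1 / s)
  | Trigonometric => IZR (sgn e) * (a / sin (a * s))
  | Hyperbolic => IZR (sgn e) * (a / sinh (a * s))
  end.

Definition Qdom (a : R) (k : Qfamily) (e : branch) (s : R) : Prop :=
  0 < IZR (sgn e) * s /\
  match k with
  | Trigonometric => IZR (sgn e) * s < PI / a
  | _ => True
  end.

(* Domains of psi: nonempty open subsets of the plane whose s-sections are
   intervals (so that the s-independent factor is one function of t) and whose
   projection to the t-axis is an interval (so that there is one integration
   constant). Open rectangles are a special case. *)
Definition tproj (D : R * R -> Prop) (t : R) : Prop := exists s, D (s, t).

Definition plane_domain (D : R * R -> Prop) : Prop :=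
  (exists p, D p) /\
  open D /\
  (forall s1 s2 s t, D (s1, t) -> D (s2, t) -> s1 <= s <= s2 -> D (s, t)) /\
  (forall t1 t2 t, tproj D t1 -> tproj D t2 -> t1 <= t <= t2 -> tproj D t).

(* psi_s = - 1/2 Q sin(2 psi); both equations include the existence of the
   partial derivative. *)
Definition first_equation (q : R -> R) (D : R * R -> Prop) (psi : R -> R -> R)
  : Prop :=
  forall s t, D (s, t) ->
    is_derive (fun x => psi x t) s (- (1 / 2) * q s * sin (2 * psi s t)).

(* psi_t = 1/2 (log Q)_s - 1/2 Q cos(2 psi) *)
Definition second_equation (q : R -> R) (D : R * R -> Prop) (psi : R -> R -> R)
  : Prop :=
  forall s t, D (s, t) ->
    is_derive (fun x => psi s x) t
      (1 / 2 * Derive (fun x => ln (q x)) s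
       - 1 / 2 * q s * cos (2 * psi s t)).

Definition congr_mod (m x y : R) : Prop := exists n : Z, x = y + IZR n * m.

Definition identically_mod (m : R) (D : R * R -> Prop) (psi : R -> R -> R)
  (c : R) : Prop :=
  forall s t, D (s, t) -> congr_mod m (psi s t) c.

(* The explicit s-dependent factor of tan psi. *)
Definition sfactor (a : R) (k : Qfamily) (e : branch) (s : R) : R :=
  match k with
  | Rational => powerRZ s (- sgn e)
  | Trigonometric => powerRZ (tan (a * s / 2)) (- sgn e)
  | Hyperbolic => powerRZ (tanh (a * s / 2)) (- sgn e)
  end.

Definition cot (x : R) : R := cos x / sin x.
Definition coth (x : R) : R := cosh x / sinh x.

(* Main.v *)
(** The first equation of the system is linear in [sin (2 psi)] along each
    s-section, so [sin (2 psi)] vanishes identically on a section or nowhere;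
    and it says that [tan psi] has logarithmic s-derivative [- Q], so that
    [tan psi = S(s) y(t)] for any [S] with [S' = - Q S].  Writing
    [cos (2 psi) = (1 - tan^2 psi) / (1 + tan^2 psi)] turns the second equation
    into [y_t = ((1 + S^2 y^2) (log Q)' - Q (1 - S^2 y^2)) / (2 S)], whose right
    hand side is independent of [s] by the half-angle formulas.  In the first
    case [psi_t = 0], hence [(log Q)' = Q] or [- Q], which no [a / sin (a s)] or
    [a / sinh (a s)] satisfies. *)

Require Import Defs.
From Stdlib Require Import Reals ZArith Lra ClassicalEpsilon.
From Coquelicot Require Import Coquelicot.
Open Scope R_scope.

(** * Calculus on intervals and uniqueness for linear equations *)

Definition convex_set (I : R -> Prop) : Prop :=
  forall x1 x2 x, I x1 -> I x2 -> x1 <= x <= x2 -> I x.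

Lemma convex_set_between (I : R -> Prop) (x y z : R) :
  convex_set I -> I x -> I y -> Rmin x y <= z <= Rmax x y -> I z.
Proof.
intros HI Hx Hy Hz.
destruct (Rle_dec x y) as [h|h].
- rewrite Rmin_left, Rmax_right in Hz by lra. now apply (HI x y).
- rewrite Rmin_right, Rmax_left in Hz by lra. now apply (HI y x).
Qed.

Lemma is_derive_continuity_pt (f : R -> R) (x l : R) :
  is_derive f x l -> continuity_pt f x.
Proof.
intros H. apply derivable_continuous_pt.
exists l. now apply is_derive_Reals.
Qed.

(** The endpoints are unordered because the base point of a section may lie on either side of the
    point of interest. *)
Lemma mvt_on (I : R -> Prop) (f df : R -> R) (x y : R) :
  convex_set I -> (forall z, I z -> is_derive f z (df z)) -> I x -> I y ->
  exists z, Rmin x y <= z <= Rmax x y /\ f y - f x = df z * (y - x).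
Proof.
intros HI Hf Hx Hy.
assert (B := fun z => convex_set_between I x y z HI Hx Hy).
destruct (MVT_gen f x y df) as [z [Hz E]].
- intros z Hz. apply Hf, B. lra.
- intros z Hz. eapply is_derive_continuity_pt, Hf, B, Hz.
- exists z. auto.
Qed.

Lemma zero_derivative_constant (I : R -> Prop) (f : R -> R) (x y : R) :
  convex_set I -> (forall z, I z -> is_derive f z 0) -> I x -> I y ->
  f x = f y.
Proof.
intros HI Hf Hx Hy.
destruct (mvt_on I f (fun _ => 0) x y HI Hf Hx Hy) as [z [_ E]]. lra.
Qed.

(* With |c| <= M between x0 and x, the function u^2 exp(2 k z), k = -M or M,
   is monotone away from x0, where it vanishes. *)
Lemma linear_ode_zero (I : R -> Prop) (u c : R -> R) (x0 x : R) :
  convex_set I ->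
  (forall z, I z -> is_derive u z (c z * u z)) ->
  (forall z, I z -> continuity_pt c z) ->
  I x0 -> I x -> u x0 = 0 -> u x = 0.
Proof.
intros HI Hu Hc H0 Hx E0.
assert (B := fun z => convex_set_between I x0 x z HI H0 Hx).
assert (Hm : Rmin x0 x <= Rmax x0 x)
  by (apply Rle_trans with x0; [apply Rmin_l | apply Rmax_l]).
destruct (continuity_ab_maj c _ _ Hm) as [z1 [M1 _]]; [auto|].
destruct (continuity_ab_min c _ _ Hm) as [z2 [M2 _]]; [auto|].
(* [c z1] is the maximum and [c z2] the minimum of [c] on the segment. Taking [k] to be minus the
   first when [x] is to the right of [x0], and minus the second when it is to the left, makes
   [c + k] zero or of sign opposite to [x - x0]. *)
assert (Hk : exists k, forall z, Rmin x0 x <= z <= Rmax x0 x ->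
          (c z + k) * (x - x0) <= 0).
{ destruct (Rle_dec x0 x) as [h|h].
  - exists (- c z1). intros z Hz. specialize (M1 z Hz). nra.
  - exists (- c z2). intros z Hz. specialize (M2 z Hz). nra. }
destruct Hk as [k Hk].
destruct (mvt_on I (fun z => u z ^ 2 * exp (2 * k * z))
  (fun z => 2 * (c z + k) * u z ^ 2 * exp (2 * k * z)) x0 x) as [z [Hz E]];
  auto.
{ intros z Hz. assert (D := Hu z Hz). auto_derive; [now exists (c z * u z)|].
  replace (Derive (fun x1 => u x1) z) with (c z * u z)
    by (symmetry; now apply is_derive_unique).
  ring. }
cbv beta in E. rewrite E0 in E. specialize (Hk z Hz).
assert (P1 := exp_pos (2 * k * x)). assert (P2 := exp_pos (2 * k * z)).
assert (0 <= u z ^ 2 * exp (2 * k * z)) by (apply Rmult_le_pos; [apply pow2_ge_0 | lra]).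
assert (u x ^ 2 * exp (2 * k * x) <= 0) by nra.
assert (u x ^ 2 <= 0) by (apply Rmult_le_reg_r with (1 := P1); lra).
nra.
Qed.

(** * Hyperbolic identities and congruences modulo multiples of pi *)

Lemma is_derive_sinh (x : R) : is_derive sinh x (cosh x).
Proof. apply is_derive_Reals, derivable_pt_lim_sinh. Qed.

Lemma is_derive_cosh (x : R) : is_derive cosh x (sinh x).
Proof. apply is_derive_Reals, derivable_pt_lim_cosh. Qed.

Lemma cosh_pos (x : R) : 0 < cosh x.
Proof.
unfold cosh. assert (H := exp_pos x). assert (H' := exp_pos (- x)). lra.
Qed.

Lemma cosh2_sinh2 (x : R) : cosh x ^ 2 = 1 + sinh x ^ 2.
Proof.
unfold cosh, sinh. rewrite exp_Ropp. field. assert (H := exp_pos x). lra.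
Qed.

Lemma sinh_double (x : R) : sinh (2 * x) = 2 * sinh x * cosh x.
Proof.
unfold cosh, sinh. rewrite !exp_Ropp.
replace (2 * x) with (x + x) by ring. rewrite exp_plus.
field. assert (H := exp_pos x). lra.
Qed.

Lemma cosh_double (x : R) : cosh (2 * x) = 1 + 2 * sinh x ^ 2.
Proof.
unfold cosh, sinh. rewrite !exp_Ropp.
replace (2 * x) with (x + x) by ring. rewrite exp_plus.
field. assert (H := exp_pos x). lra.
Qed.

Lemma is_derive_tanh (x : R) : is_derive tanh x (1 - tanh x ^ 2).
Proof.
assert (H := cosh_pos x).
replace (1 - tanh x ^ 2)
  with ((cosh x * cosh x - sinh x * sinh x) / cosh x ^ 2)
  by (unfold tanh; field; lra).
apply is_derive_div; [apply is_derive_sinh | apply is_derive_cosh | lra].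
Qed.

(** This form and the one for [coth] below differ only in the sign of the exponential, which is how
    the two kinds of solution of [y' = a/2 (y^2 - 1)] are told apart. *)
Lemma tanh_exp (x : R) : tanh x = (1 - exp (- (2 * x))) / (1 + exp (- (2 * x))).
Proof.
unfold tanh, sinh, cosh.
replace (- (2 * x)) with (- x + - x) by ring.
rewrite exp_plus, exp_Ropp. assert (H := exp_pos x). field. split; nra.
Qed.

Lemma coth_exp (x : R) :
  sinh x <> 0 -> coth x = (1 + exp (- (2 * x))) / (1 - exp (- (2 * x))).
Proof.
unfold coth, sinh, cosh.
replace (- (2 * x)) with (- x + - x) by ring.
rewrite exp_plus, exp_Ropp. assert (H := exp_pos x). intros H0.
assert (exp x * exp x - 1 <> 0).
{ intros E. apply H0. apply Rmult_eq_reg_r with (2 * exp x); [|lra].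
  transitivity (exp x * exp x - 1); [field|]; lra. }
field. split; lra.
Qed.

Lemma congr_half_pi (x : R) : congr_mod (PI / 2) x 0 <-> sin (2 * x) = 0.
Proof.
split.
- intros [n E]. apply sin_eq_0_1. exists n. lra.
- intros H. destruct (sin_eq_0_0 _ H) as [n E]. exists n. lra.
Qed.

Lemma congr_pi_0 (x : R) : congr_mod PI x 0 <-> sin x = 0.
Proof.
split.
- intros [n E]. apply sin_eq_0_1. exists n. lra.
- intros H. destruct (sin_eq_0_0 _ H) as [n E]. exists n. lra.
Qed.

Lemma congr_pi_half_pi (x : R) : congr_mod PI x (PI / 2) <-> cos x = 0.
Proof.
split.
- intros [n E]. apply cos_eq_0_1. exists n. lra.
- intros H. destruct (cos_eq_0_0 _ H) as [n E]. exists n. lra.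
Qed.

(** * The functions Q and their logarithmic derivatives *)

(** This is the closed form of [(log Q)_s]; the sign of the branch cancels in [Q' / Q], so there is
    no branch argument. *)
Definition Qlogder (a : R) (k : Qfamily) (s : R) : R :=
  match k with
  | Rational => - (1 / s)
  | Trigonometric => - (a * cos (a * s) / sin (a * s))
  | Hyperbolic => - (a * cosh (a * s) / sinh (a * s))
  end.

Lemma sgn_square (e : branch) : IZR (sgn e) * IZR (sgn e) = 1.
Proof. destruct e; simpl; lra. Qed.

(** The half angle [a s / 2] lies strictly between 0 and pi/2 up to the sign of the branch, so both
    [tan (a s / 2)] and its reciprocal are legitimate. *)
Lemma Qdom_trig_half (a : R) (e : branch) (s : R) :
  0 < a -> Qdom a Trigonometric e s ->
  0 < IZR (sgn e) * sin (a * s / 2) /\ 0 < cos (a * s / 2).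
Proof.
intros Ha [H1 H2].
assert (IZR (sgn e) * (a * s) < PI).
{ apply Rmult_lt_compat_r with (r := a) in H2; auto.
  replace (PI / a * a) with PI in H2 by (field; lra). lra. }
assert (0 < a * (IZR (sgn e) * s)) by (apply Rmult_lt_0_compat; lra).
destruct e; simpl in *; split;
  try (apply cos_gt_0; lra).
- rewrite Rmult_1_l. apply sin_gt_0; lra.
- replace (-1 * sin (a * s / 2)) with (sin (- (a * s / 2)))
    by (rewrite sin_neg; ring).
  apply sin_gt_0; lra.
Qed.

Lemma Qdom_hyp_half (a : R) (e : branch) (s : R) :
  0 < a -> Qdom a Hyperbolic e s -> 0 < IZR (sgn e) * sinh (a * s / 2).
Proof.
intros Ha [H1 _].
assert (0 < a * (IZR (sgn e) * s)) by (apply Rmult_lt_0_compat; lra).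
destruct e; simpl in *.
- assert (H0 := sinh_lt 0 (a * s / 2)). rewrite sinh_0 in H0. lra.
- assert (H0 := sinh_lt (a * s / 2) 0). rewrite sinh_0 in H0. lra.
Qed.

Lemma trig_half (a s : R) :
  sin (a * s) = 2 * sin (a * s / 2) * cos (a * s / 2) /\
  cos (a * s) = 1 - 2 * sin (a * s / 2) ^ 2.
Proof.
assert (E : a * s = 2 * (a * s / 2)) by field. split.
- rewrite E at 1. now rewrite sin_2a.
- rewrite E at 1. rewrite cos_2a_sin. ring.
Qed.

Lemma hyp_half (a s : R) :
  sinh (a * s) = 2 * sinh (a * s / 2) * cosh (a * s / 2) /\
  cosh (a * s) = 1 + 2 * sinh (a * s / 2) ^ 2.
Proof.
assert (E : a * s = 2 * (a * s / 2)) by field. split.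
- rewrite E at 1. now rewrite sinh_double.
- rewrite E at 1. now rewrite cosh_double.
Qed.

Lemma Q_denominator_pos (a : R) (k : Qfamily) (e : branch) (s : R) :
  0 < a -> Qdom a k e s ->
  0 < IZR (sgn e) *
      match k with
      | Rational => s
      | Trigonometric => sin (a * s)
      | Hyperbolic => sinh (a * s)
      end.
Proof.
intros Ha H. destruct k.
- exact (proj1 H).
- destruct (Qdom_trig_half a e s Ha H) as [H1 H2].
  rewrite (proj1 (trig_half a s)). nra.
- assert (H1 := Qdom_hyp_half a e s Ha H). assert (H2 := cosh_pos (a * s / 2)).
  rewrite (proj1 (hyp_half a s)). nra.
Qed.

Lemma Q_pos (a : R) (k : Qfamily) (e : branch) (s : R) :
  0 < a -> Qdom a k e s -> 0 < Q a k e s.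
Proof.
intros Ha H. assert (P := Q_denominator_pos a k e s Ha H).
assert (S := sgn_square e).
assert (G : forall b d, 0 < b -> 0 < IZR (sgn e) * d -> 0 < IZR (sgn e) * (b / d)).
{ intros b d Hb Hd. assert (d <> 0) by (intros ->; lra).
  replace (IZR (sgn e) * (b / d)) with (b / (IZR (sgn e) * d) * (IZR (sgn e) * IZR (sgn e))).
  - rewrite S, Rmult_1_r. now apply Rdiv_lt_0_compat.
  - field. split; auto. intros E0; rewrite E0 in S; lra. }
destruct k; apply G; lra.
Qed.

Lemma Q_derive (a : R) (k : Qfamily) (e : branch) (s : R) :
  0 < a -> Qdom a k e s ->
  is_derive (Q a k e) s (Qlogder a k s * Q a k e s).
Proof.
intros Ha H. assert (P := Q_denominator_pos a k e s Ha H).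
destruct k; unfold Q, Qlogder.
- assert (s <> 0) by (intros ->; lra). auto_derive; auto. field; auto.
- assert (sin (a * s) <> 0) by (intros E; rewrite E in P; lra).
  auto_derive; auto. field; auto.
- assert (sinh (a * s) <> 0) by (intros E; rewrite E in P; lra).
  auto_derive; auto. field; auto.
Qed.

Lemma ln_Q_derive (a : R) (k : Qfamily) (e : branch) (s : R) :
  0 < a -> Qdom a k e s ->
  is_derive (fun x => ln (Q a k e x)) s (Qlogder a k s).
Proof.
intros Ha H. assert (P := Q_pos a k e s Ha H).
replace (Qlogder a k s) with (scal (Qlogder a k s * Q a k e s) (/ Q a k e s)).
- apply (is_derive_comp ln (Q a k e)); [now apply is_derive_ln | now apply Q_derive].
- unfold scal; simpl; unfold mult; simpl. field. lra.
Qed.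

(** Cancelling the common factor leaves [cos (a s)] or [cosh (a s)] equal to 1 or -1, which would
    force [sin (a s)] or [sinh (a s)] to vanish. Only [1 / s] survives, and there the sign is read
    off. It is applied with [c = cos (2 psi)]. *)
Lemma Qlogder_proportional (a : R) (k : Qfamily) (e : branch) (s c : R) :
  0 < a -> Qdom a k e s -> c * c = 1 -> Qlogder a k s = c * Q a k e s ->
  k = Rational /\ c = - IZR (sgn e).
Proof.
intros Ha H Hc E.
assert (P := Q_denominator_pos a k e s Ha H). assert (S := sgn_square e).
unfold Qlogder, Q in E. destruct k.
- split; auto. assert (Hs : s <> 0) by (intros ->; lra).
  assert (-1 = c * IZR (sgn e)).
  { apply Rmult_eq_reg_r with (/ s); [|now apply Rinv_neq_0_compat]. lra. }
  apply Rmult_eq_reg_r with (IZR (sgn e)); [lra|]. intros E0; rewrite E0 in S; lra.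
- exfalso. assert (H0 : sin (a * s) <> 0) by (intros E0; rewrite E0 in P; lra).
  assert (- cos (a * s) = c * IZR (sgn e)).
  { apply Rmult_eq_reg_r with (a / sin (a * s)).
    - lra.
    - unfold Rdiv. apply Rmult_integral_contrapositive_currified; [lra|now apply Rinv_neq_0_compat]. }
  assert (X := sin2_cos2 (a * s)). unfold Rsqr in X.
  assert (cos (a * s) * cos (a * s) = (c * c) * (IZR (sgn e) * IZR (sgn e))) by nra.
  nra.
- exfalso. assert (H0 : sinh (a * s) <> 0) by (intros E0; rewrite E0 in P; lra).
  assert (- cosh (a * s) = c * IZR (sgn e)).
  { apply Rmult_eq_reg_r with (a / sinh (a * s)).
    - lra.
    - unfold Rdiv. apply Rmult_integral_contrapositive_currified; [lra|now apply Rinv_neq_0_compat]. }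
  assert (X := cosh2_sinh2 (a * s)).
  assert (cosh (a * s) * cosh (a * s) = (c * c) * (IZR (sgn e) * IZR (sgn e))) by nra.
  nra.
Qed.


(** * The s-dependent factor of tan psi *)

(** Raising to the power -1 or 1 multiplies a logarithmic derivative by that exponent. This treats
    both branches at once, with [b] one of [s], [tan (a s / 2)], [tanh (a s / 2)] and [l] the
    function [Q] stripped of its sign. *)
Lemma powerRZ_sgn_derive (b : R -> R) (e : branch) (s l : R) :
  b s <> 0 -> is_derive b s (l * b s) ->
  powerRZ (b s) (- sgn e) <> 0 /\
  is_derive (fun x => powerRZ (b x) (- sgn e)) s
    (- (IZR (sgn e) * l) * powerRZ (b s) (- sgn e)).
Proof.
intros H0 D. destruct e; simpl.
- split.
  + apply Rinv_neq_0_compat. lra.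
  + apply is_derive_ext with (fun x => / b x).
    { intros x. now rewrite Rmult_1_r. }
    replace (- (1 * l) * / (b s * 1)) with (- (l * b s) / b s ^ 2) by (field; lra).
    now apply is_derive_inv.
- split; [lra|].
  apply is_derive_ext with b; [intros x; symmetry; apply Rmult_1_r|].
  replace (- (-1 * l) * (b s * 1)) with (l * b s) by ring. exact D.
Qed.

(** By the double-angle formulas, the logarithmic derivatives of [tan (a s / 2)] and
    [tanh (a s / 2)] are [a / sin (a s)] and [a / sinh (a s)]. *)
Lemma sfactor_derive (a : R) (k : Qfamily) (e : branch) (s : R) :
  0 < a -> Qdom a k e s ->
  sfactor a k e s <> 0 /\
  is_derive (sfactor a k e) s (- Q a k e s * sfactor a k e s).
Proof.
intros Ha H. destruct k.
- apply (powerRZ_sgn_derive (fun x => x) e s (1 / s)).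
  + intros ->. destruct H. lra.
  + assert (s <> 0) by (intros ->; destruct H; lra).
    auto_derive; auto. field; auto.
- destruct (Qdom_trig_half a e s Ha H) as [H1 H2].
  assert (sin (a * s / 2) <> 0) by (intros E0; rewrite E0 in H1; lra).
  assert (X := sin2_cos2 (a * s / 2)). unfold Rsqr in X.
  apply (powerRZ_sgn_derive (fun x => tan (a * x / 2)) e s (a / sin (a * s))).
  + unfold tan. apply Rmult_integral_contrapositive_currified; auto.
    apply Rinv_neq_0_compat; lra.
  + rewrite (proj1 (trig_half a s)).
    replace (a / (2 * sin (a * s / 2) * cos (a * s / 2)) * tan (a * s / 2))
      with (scal (a / 2) (tan (a * s / 2) ^ 2 + 1)).
    * apply (is_derive_comp tan (fun x => a * x / 2)).
      { apply is_derive_tan. lra. }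
      auto_derive; auto. field.
    * unfold scal; simpl; unfold mult; simpl. unfold tan.
      replace (sin (a * s / 2) / cos (a * s / 2) *
               (sin (a * s / 2) / cos (a * s / 2) * 1) + 1)
        with ((sin (a * s / 2) * sin (a * s / 2) + cos (a * s / 2) * cos (a * s / 2)) / cos (a * s / 2) ^ 2)
        by (field; lra).
      rewrite X. field. lra.
- assert (H1 := Qdom_hyp_half a e s Ha H). assert (H2 := cosh_pos (a * s / 2)).
  assert (sinh (a * s / 2) <> 0) by (intros E0; rewrite E0 in H1; lra).
  assert (X := cosh2_sinh2 (a * s / 2)).
  apply (powerRZ_sgn_derive (fun x => tanh (a * x / 2)) e s (a / sinh (a * s))).
  + unfold tanh. apply Rmult_integral_contrapositive_currified; auto.
    apply Rinv_neq_0_compat; lra.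
  + rewrite (proj1 (hyp_half a s)).
    replace (a / (2 * sinh (a * s / 2) * cosh (a * s / 2)) * tanh (a * s / 2))
      with (scal (a / 2) (1 - tanh (a * s / 2) ^ 2)).
    * apply (is_derive_comp tanh (fun x => a * x / 2)).
      { apply is_derive_tanh. }
      auto_derive; auto. field.
    * unfold scal; simpl; unfold mult; simpl. unfold tanh.
      replace (1 - sinh (a * s / 2) / cosh (a * s / 2) *
               (sinh (a * s / 2) / cosh (a * s / 2) * 1))
        with ((cosh (a * s / 2) ^ 2 - sinh (a * s / 2) ^ 2) / cosh (a * s / 2) ^ 2)
        by (field; lra).
      replace (cosh (a * s / 2) ^ 2 - sinh (a * s / 2) ^ 2) with 1 by lra.
      field. lra.
Qed.

(** * The two equations expressed through tan psi *)

Lemma open_locally_t (D : R * R -> Prop) (s t : R) :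
  open D -> D (s, t) -> locally t (fun x => D (s, x)).
Proof.
intros HD H. destruct (HD _ H) as [eps He].
exists eps. intros x Hx. apply He. split; [apply ball_center | exact Hx].
Qed.

(** Along a section [u = sin (2 psi)] satisfies [u_s = - q cos (2 psi) u], a linear equation with
    continuous coefficient; differentiability of [q] supplies the continuity. *)
Lemma first_equation_sin_zero (q dq : R -> R) (D : R * R -> Prop)
  (psi : R -> R -> R) (t s0 s : R) :
  convex_set (fun x => D (x, t)) ->
  (forall x, D (x, t) -> is_derive q x (dq x)) ->
  first_equation q D psi ->
  D (s0, t) -> D (s, t) -> sin (2 * psi s0 t) = 0 -> sin (2 * psi s t) = 0.
Proof.
intros HI Hq HF H0 H E.
apply (linear_ode_zero (fun x => D (x, t)) (fun x => sin (2 * psi x t))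
  (fun x => - (q x * cos (2 * psi x t))) s0 s); auto.
- intros x Hx. assert (F := HF x t Hx).
  auto_derive; [now exists (- (1 / 2) * q x * sin (2 * psi x t))|].
  replace (Derive (fun x1 => psi x1 t) x) with (- (1 / 2) * q x * sin (2 * psi x t))
    by (symmetry; now apply is_derive_unique).
  field.
- intros x Hx. assert (F := HF x t Hx). assert (G := Hq x Hx).
  eapply (is_derive_continuity_pt (fun x => - (q x * cos (2 * psi x t)))).
  auto_derive; [|reflexivity].
  repeat split; [now exists (dq x) | now exists (- (1 / 2) * q x * sin (2 * psi x t))].
Qed.

Lemma tan_comp_derive (f : R -> R) (x l : R) :
  cos (f x) <> 0 -> is_derive f x l ->
  is_derive (fun z => tan (f z)) x ((1 + tan (f x) ^ 2) * l).
Proof.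
intros H Hf.
replace ((1 + tan (f x) ^ 2) * l) with (scal l (tan (f x) ^ 2 + 1)).
- apply (is_derive_comp tan f); [now apply is_derive_tan | exact Hf].
- unfold scal; simpl; unfold mult; simpl. ring.
Qed.

(** Here and in [cos_2_tan] the factor [1 + tan^2] stays on the left, since it is the one produced
    by differentiating [tan psi]. *)
Lemma sin_2_tan (x : R) :
  cos x <> 0 -> (1 + tan x ^ 2) * sin (2 * x) = 2 * tan x.
Proof.
intros H. rewrite sin_2a. assert (X := sin2_cos2 x). unfold Rsqr in X.
unfold tan.
replace (1 + (sin x / cos x) ^ 2)
  with ((sin x * sin x + cos x * cos x) / cos x ^ 2) by (field; auto).
rewrite X. field; auto.
Qed.

Lemma cos_2_tan (x : R) :
  cos x <> 0 -> (1 + tan x ^ 2) * cos (2 * x) = 1 - tan x ^ 2.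
Proof.
intros H. rewrite cos_2a. assert (X := sin2_cos2 x). unfold Rsqr in X.
unfold tan.
replace (1 + (sin x / cos x) ^ 2)
  with ((sin x * sin x + cos x * cos x) / cos x ^ 2) by (field; auto).
rewrite X. field; auto.
Qed.

(** The quotient [tan psi / S] has zero s-derivative, so it is constant on each section, which is an
    interval. [S] is kept general to cover both [exp (- P)] and [sfactor]. *)
Lemma tan_factorization (q S : R -> R) (D : R * R -> Prop) (psi : R -> R -> R) :
  (forall t, convex_set (fun s => D (s, t))) ->
  first_equation q D psi ->
  (forall s t, D (s, t) -> cos (psi s t) <> 0) ->
  (forall s t, D (s, t) -> S s <> 0 /\ is_derive S s (- q s * S s)) ->
  exists y : R -> R, forall s t, D (s, t) -> tan (psi s t) = S s * y t.
Proof.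
intros HI HF Hc HS.
(* [y t] is the quotient at a base point chosen in the section over [t]; over an empty section the
   choice is arbitrary and nothing is claimed. *)
exists (fun t => let s0 := epsilon (inhabits 0) (fun s => D (s, t)) in
                 tan (psi s0 t) / S s0).
intros s t H. cbv zeta.
set (s0 := epsilon _ _).
assert (H0 : D (s0, t)).
{ unfold s0. apply (epsilon_spec (inhabits 0) (fun s => D (s, t))). now exists s. }
clearbody s0.
assert (E : tan (psi s t) / S s = tan (psi s0 t) / S s0).
{ apply (zero_derivative_constant (fun s => D (s, t))
           (fun s => tan (psi s t) / S s)); auto.
  intros z Hz. destruct (HS z t Hz) as [S0 S1].
  assert (T := tan_comp_derive _ _ _ (Hc z t Hz) (HF z t Hz)).
  replace 0 with (((1 + tan (psi z t) ^ 2) * (- (1 / 2) * q z * sin (2 * psi z t)) * S z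
                   - tan (psi z t) * (- q z * S z)) / S z ^ 2).
  - now apply (is_derive_div (fun x => tan (psi x t)) S).
  - replace ((1 + tan (psi z t) ^ 2) * (- (1 / 2) * q z * sin (2 * psi z t)))
      with (- (1 / 2) * q z * ((1 + tan (psi z t) ^ 2) * sin (2 * psi z t))) by ring.
    rewrite sin_2_tan by auto. field; auto. }
rewrite <- E. field. now apply (HS s t).
Qed.

(** For fixed [s], [y = tan psi / S] inherits a t-derivative from [psi]. The resulting formula still
    displays [s]; the computations for each family then remove it. *)
Lemma tan_factor_derive (a : R) (k : Qfamily) (e : branch) (D : R * R -> Prop)
  (psi : R -> R -> R) (y : R -> R) (s t : R) :
  0 < a -> open D -> (forall s t, D (s, t) -> Qdom a k e s) ->
  second_equation (Q a k e) D psi ->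
  (forall s t, D (s, t) -> cos (psi s t) <> 0) ->
  (forall s t, D (s, t) -> tan (psi s t) = sfactor a k e s * y t) ->
  D (s, t) ->
  is_derive y t
    (1 / 2 * ((1 + (sfactor a k e s * y t) ^ 2) * Qlogder a k s
              - Q a k e s * (1 - (sfactor a k e s * y t) ^ 2))
     / sfactor a k e s).
Proof.
intros Ha HO HQ HS Hc Hy H.
destruct (sfactor_derive a k e s Ha (HQ s t H)) as [S0 _].
assert (T := tan_comp_derive (fun x => psi s x) _ _ (Hc s t H) (HS s t H)).
assert (L : Derive (fun x => ln (Q a k e x)) s = Qlogder a k s)
  by exact (is_derive_unique _ _ _ (ln_Q_derive a k e s Ha (HQ s t H))).
rewrite L in T.
assert (C := cos_2_tan _ (Hc s t H)).
rewrite <- (Hy s t H).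
(* The factorization is available only on [D]; openness makes it valid for all times near [t] at the
   same [s]. *)
apply is_derive_ext_loc with (fun x => / sfactor a k e s * tan (psi s x)).
{ destruct (open_locally_t D s t HO H) as [eps He]. exists eps. intros x Hx.
  rewrite (Hy s x (He x Hx)). change (/ sfactor a k e s * (sfactor a k e s * y x) = y x).
  field; auto. }
replace (1 / 2 * ((1 + tan (psi s t) ^ 2) * Qlogder a k s -
   Q a k e s * (1 - tan (psi s t) ^ 2)) / sfactor a k e s)
  with (/ sfactor a k e s * ((1 + tan (psi s t) ^ 2) *
        (1 / 2 * Qlogder a k s - 1 / 2 * Q a k e s * cos (2 * psi s t)))).
- now apply is_derive_scal.
- rewrite <- C. field; auto.
Qed.

(** * The equations for y, with s eliminated *)

Lemma y_ode_rational_upper (a s y : R) :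
  Qdom a Rational Upper s ->
  1 / 2 * ((1 + (sfactor a Rational Upper s * y) ^ 2) * Qlogder a Rational s
           - Q a Rational Upper s * (1 - (sfactor a Rational Upper s * y) ^ 2))
     / sfactor a Rational Upper s = - 1.
Proof.
intros [H _]. simpl in *. field. lra.
Qed.

Lemma y_ode_rational_lower (a s y : R) :
  Qdom a Rational Lower s ->
  1 / 2 * ((1 + (sfactor a Rational Lower s * y) ^ 2) * Qlogder a Rational s
           - Q a Rational Lower s * (1 - (sfactor a Rational Lower s * y) ^ 2))
     / sfactor a Rational Lower s = - (y ^ 2).
Proof.
intros [H _]. simpl in *. field. lra.
Qed.

Lemma y_ode_trigonometric_upper (a s y : R) :
  0 < a -> Qdom a Trigonometric Upper s ->
  1 / 2 * ((1 + (sfactor a Trigonometric Upper s * y) ^ 2) * Qlogder a Trigonometric s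
           - Q a Trigonometric Upper s * (1 - (sfactor a Trigonometric Upper s * y) ^ 2))
     / sfactor a Trigonometric Upper s = a / 2 * (y ^ 2 - 1).
Proof.
intros Ha H. destruct (Qdom_trig_half a Upper s Ha H) as [H1 H2]. simpl in *.
destruct (trig_half a s) as [E1 E2]. rewrite E1. unfold tan.
assert (X := sin2_cos2 (a * s / 2)). unfold Rsqr in X.
set (S := sin (a * s / 2)) in *. set (C := cos (a * s / 2)) in *.
set (c := cos (a * s)) in *.
(* Sorting by powers of [y] isolates [1 + cos (a s) = 2 C^2] and [1 - cos (a s) = 2 S^2], after
   which [S] and [C] cancel. *)
transitivity (- a / (4 * C ^ 2) * ((1 + c) - (y * C / S) ^ 2 * (1 - c))).
- field. lra.
- replace (1 + c) with (2 * C ^ 2) by lra.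
  replace (1 - c) with (2 * S ^ 2) by lra.
  field. lra.
Qed.

Lemma y_ode_hyperbolic_upper (a s y : R) :
  0 < a -> Qdom a Hyperbolic Upper s ->
  1 / 2 * ((1 + (sfactor a Hyperbolic Upper s * y) ^ 2) * Qlogder a Hyperbolic s
           - Q a Hyperbolic Upper s * (1 - (sfactor a Hyperbolic Upper s * y) ^ 2))
     / sfactor a Hyperbolic Upper s = - (a / 2) * (1 + y ^ 2).
Proof.
intros Ha H. assert (H1 := Qdom_hyp_half a Upper s Ha H).
assert (H2 := cosh_pos (a * s / 2)). simpl in *.
destruct (hyp_half a s) as [E1 E2]. rewrite E1. unfold tanh.
assert (X := cosh2_sinh2 (a * s / 2)).
set (S := sinh (a * s / 2)) in *. set (C := cosh (a * s / 2)) in *.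
set (c := cosh (a * s)) in *.
(* Same sorting; now [cosh (a s) - 1 = 2 S^2] enters with a plus sign, whence [1 + y^2] in place of
   [y^2 - 1]. *)
transitivity (- a / (4 * C ^ 2) * ((1 + c) + (y * C / S) ^ 2 * (c - 1))).
- field. lra.
- replace (1 + c) with (2 * C ^ 2) by lra.
  replace (c - 1) with (2 * S ^ 2) by lra.
  field. lra.
Qed.

(** * Integration of the equations for y *)

Lemma integrate_constant_slope (J : R -> Prop) (f : R -> R) (m : R) :
  convex_set J -> (forall t, J t -> is_derive f t m) ->
  exists c, forall t, J t -> f t = m * t + c.
Proof.
intros HJ Hf.
destruct (classic (exists t0, J t0)) as [[t0 H0]|N].
- exists (f t0 - m * t0). intros t Ht.
  assert (E : f t - m * t = f t0 - m * t0); [|lra].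
  apply (zero_derivative_constant J (fun x => f x - m * x)); auto.
  intros z Hz. assert (F := Hf z Hz). auto_derive; [now exists m|].
  replace (Derive (fun x => f x) z) with m by (symmetry; now apply is_derive_unique).
  ring.
- exists 0. intros t Ht. exfalso. apply N. now exists t.
Qed.

(** Read as [y' = (- y) y], the equation is linear, so one zero forces [y = 0] throughout. Otherwise
    [1 / y] has slope 1. *)
Lemma integrate_minus_square (J : R -> Prop) (y : R -> R) :
  convex_set J -> (forall t, J t -> is_derive y t (- (y t) ^ 2)) ->
  (forall t, J t -> y t = 0) \/
  exists sigma, forall t, J t -> t + sigma <> 0 /\ y t = 1 / (t + sigma).
Proof.
intros HJ Hy.
destruct (classic (exists t0, J t0 /\ y t0 = 0)) as [[t0 [H0 E0]]|N].
- left. intros t Ht.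
  apply (linear_ode_zero J y (fun x => - y x) t0 t); auto.
  + intros z Hz. replace (- y z * y z) with (- (y z) ^ 2) by ring. auto.
  + intros z Hz. apply continuity_pt_opp.
    exact (is_derive_continuity_pt _ _ _ (Hy z Hz)).
- right.
  assert (Y0 : forall t, J t -> y t <> 0) by (intros t Ht E; apply N; eauto).
  destruct (integrate_constant_slope J (fun t => / y t) 1) as [c Hc]; auto.
  + intros t Ht.
    replace 1 with (- (- (y t) ^ 2) / y t ^ 2) by (field; auto).
    apply is_derive_inv; auto.
  + exists c. intros t Ht. specialize (Hc t Ht). specialize (Y0 t Ht).
    replace (t + c) with (/ y t) by lra. split.
    * now apply Rinv_neq_0_compat.
    * field; auto.
Qed.

(* Away from the constant solutions, (1 + y) / (1 - y) is a nonzero multiple of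
   exp (- a t); the sign of the multiple separates tanh from coth. *)
Lemma integrate_square_minus_one (J : R -> Prop) (y : R -> R) (a : R) :
  convex_set J -> (forall t, J t -> is_derive y t (a / 2 * ((y t) ^ 2 - 1))) ->
  (exists eta, forall t, J t -> y t = - tanh (a * t / 2 + eta)) \/
  (forall t, J t -> y t = 1) \/
  (forall t, J t -> y t = - 1) \/
  (exists eta, forall t, J t ->
     sinh (a * t / 2 + eta) <> 0 /\ y t = - coth (a * t / 2 + eta)).
Proof.
intros HJ Hy.
(* For [b] equal to 1 or -1, [y^2 - 1 = (y - b) (y + b)] makes the equation linear in [y - b], so a
   solution that meets the stationary value [b] stays there. *)
assert (ST : forall b, b * b = 1 -> forall t0 t, J t0 -> J t -> y t0 = b -> y t = b).
{ intros b Hb t0 t H0 Ht E0. apply Rminus_diag_uniq.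
  apply (linear_ode_zero J (fun x => y x - b) (fun x => a / 2 * (y x + b)) t0 t);
    auto; [ | | lra].
  - intros z Hz. assert (F := Hy z Hz).
    auto_derive; [now exists (a / 2 * (y z ^ 2 - 1))|].
    replace (Derive (fun x => y x) z) with (a / 2 * (y z ^ 2 - 1))
      by (symmetry; now apply is_derive_unique).
    transitivity (a / 2 * (y z ^ 2 - b * b)); [rewrite Hb|]; ring.
  - intros z Hz. assert (F := Hy z Hz).
    eapply (is_derive_continuity_pt (fun x => a / 2 * (y x + b))).
    auto_derive; [|reflexivity]. now exists (a / 2 * (y z ^ 2 - 1)). }
destruct (classic (exists t0, J t0)) as [[t0 J0]|N].
2: { left. exists 0. intros t Ht. exfalso. apply N. now exists t. }
destruct (Req_dec (y t0) 1) as [E1|N1].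
{ right; left. intros t Ht. apply (ST 1 ltac:(ring) t0); auto. }
destruct (Req_dec (y t0) (- 1)) as [E2|N2].
{ right; right; left. intros t Ht. apply (ST (- 1) ltac:(ring) t0); auto. }
assert (Y1 : forall t, J t -> 1 - y t <> 0).
{ intros t Ht E. apply N1. apply (ST 1 ltac:(ring) t); auto. lra. }
(* [C] is the value of the first integral [(1 + y) / (1 - y) exp (a t)]. *)
set (C := (1 + y t0) / (1 - y t0) * exp (a * t0)).
assert (HC : forall t, J t -> 1 + y t = (1 - y t) * (C * exp (- (a * t)))).
{ intros t Ht.
  assert (E : (1 + y t) / (1 - y t) * exp (a * t) = C).
  { apply (zero_derivative_constant J
             (fun t => (1 + y t) / (1 - y t) * exp (a * t))); auto.
    intros z Hz. assert (F := Hy z Hz). specialize (Y1 z Hz).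
    auto_derive; [repeat split; auto; now exists (a / 2 * (y z ^ 2 - 1))|].
    replace (Derive (fun x => y x) z) with (a / 2 * (y z ^ 2 - 1))
      by (symmetry; now apply is_derive_unique).
    field; auto. }
  rewrite <- E, exp_Ropp. specialize (Y1 t Ht). assert (P := exp_pos (a * t)).
  field. split; lra. }
assert (C0 : C <> 0).
{ unfold C. assert (P := exp_pos (a * t0)). specialize (Y1 t0 J0).
  apply Rmult_integral_contrapositive_currified; [|lra].
  apply Rmult_integral_contrapositive_currified; [lra|now apply Rinv_neq_0_compat]. }
clearbody C.
(* Chosen so that the exponential in [tanh_exp] and [coth_exp] at [a t / 2 + eta] equals
   [|C| exp (- a t)]. *)
set (eta := - ln (Rabs C) / 2).
assert (HE : forall t, exp (- (2 * (a * t / 2 + eta))) = Rabs C * exp (- (a * t))).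
{ intros t. unfold eta.
  replace (- (2 * (a * t / 2 + - ln (Rabs C) / 2))) with (ln (Rabs C) + - (a * t)) by field.
  rewrite exp_plus, exp_ln; auto. now apply Rabs_pos_lt. }
destruct (Rtotal_order C 0) as [h|[h|h]]; [|contradiction|].
- right; right; right. exists eta. intros t Ht.
  specialize (HC t Ht). specialize (HE t). specialize (Y1 t Ht).
  rewrite Rabs_left in HE by auto.
  replace (C * exp (- (a * t))) with (- exp (- (2 * (a * t / 2 + eta)))) in HC by lra.
  assert (N0 : sinh (a * t / 2 + eta) <> 0).
  (* A zero of [sinh] would make the exponential 1, and [HC] would become [1 + y = - (1 - y)]. *)
  { intros E0.
    assert (X : exp (- (2 * (a * t / 2 + eta))) = 1); [|rewrite X in HC; lra].
    replace (- (2 * (a * t / 2 + eta)))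
      with (- (a * t / 2 + eta) + - (a * t / 2 + eta)) by ring.
    rewrite exp_plus. unfold sinh in E0.
    replace (exp (- (a * t / 2 + eta))) with (exp (a * t / 2 + eta)) at 1 by lra.
    rewrite <- exp_plus, Rplus_opp_r. apply exp_0. }
  split; auto. rewrite coth_exp by auto.
  set (E := exp _) in *.
  assert (1 - E <> 0) by (intros E1; replace E with 1 in HC by lra; lra).
  apply Rmult_eq_reg_r with (1 - E); auto.
  transitivity (- (1 + E)); [lra | field; auto].
- left. exists eta. intros t Ht.
  specialize (HC t Ht). specialize (HE t).
  rewrite Rabs_right in HE by lra. rewrite <- HE in HC.
  rewrite tanh_exp. assert (P := exp_pos (- (2 * (a * t / 2 + eta)))).
  set (E := exp _) in *.
  apply Rmult_eq_reg_r with (1 + E); [|lra].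
  transitivity (- (1 - E)); [lra | field; lra].
Qed.

(** [atan y] has constant slope [- a / 2]. Its range, the open interval from -pi/2 to pi/2, keeps
    the phase away from the zeros of [cos]. *)
Lemma integrate_minus_one_plus_square (J : R -> Prop) (y : R -> R) (a : R) :
  convex_set J -> (forall t, J t -> is_derive y t (- (a / 2) * (1 + (y t) ^ 2))) ->
  exists eta, forall t, J t ->
    cos (a * t / 2 + eta) <> 0 /\ y t = - tan (a * t / 2 + eta).
Proof.
intros HJ Hy.
destruct (integrate_constant_slope J (fun t => atan (y t)) (- (a / 2))) as [c Hc]; auto.
- intros t Ht.
  replace (- (a / 2)) with (scal (- (a / 2) * (1 + (y t) ^ 2)) (/ (1 + Rsqr (y t)))).
  + apply (is_derive_comp atan y); [apply is_derive_atan | auto].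
  + unfold scal; simpl; unfold mult; simpl. unfold Rsqr. field. nra.
- exists (- c). intros t Ht. specialize (Hc t Ht). cbv beta in Hc.
  assert (B := atan_bound (y t)).
  replace (a * t / 2 + - c) with (- atan (y t)) by lra. split.
  + rewrite cos_neg. apply Rgt_not_eq. apply cos_gt_0; lra.
  + rewrite tan_neg, tan_atan. ring.
Qed.

(** * The case where sin (2 psi) vanishes identically *)

(* Where sin (2 psi) vanishes identically, so does its t-derivative
   2 cos (2 psi) psi_t, and cos (2 psi) = +-1. *)
Lemma half_pi_multiple_second_equation (a : R) (k : Qfamily) (e : branch)
  (D : R * R -> Prop) (psi : R -> R -> R) (s t : R) :
  0 < a -> open D -> (forall s t, D (s, t) -> Qdom a k e s) ->
  second_equation (Q a k e) D psi ->
  identically_mod (PI / 2) D psi 0 -> D (s, t) ->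
  cos (2 * psi s t) * cos (2 * psi s t) = 1 /\
  Qlogder a k s = cos (2 * psi s t) * Q a k e s.
Proof.
intros Ha HO HQ HS HM H.
assert (Z : sin (2 * psi s t) = 0) by (apply congr_half_pi; auto).
assert (C : cos (2 * psi s t) * cos (2 * psi s t) = 1).
{ assert (X := sin2_cos2 (2 * psi s t)). unfold Rsqr in X. rewrite Z in X. lra. }
split; auto.
assert (F := HS s t H).
assert (L : Derive (fun x => ln (Q a k e x)) s = Qlogder a k s)
  by exact (is_derive_unique _ _ _ (ln_Q_derive a k e s Ha (HQ s t H))).
rewrite L in F.
set (l := 1 / 2 * Qlogder a k s - 1 / 2 * Q a k e s * cos (2 * psi s t)) in *.
assert (G : is_derive (fun x => sin (2 * psi s x)) t (2 * cos (2 * psi s t) * l)).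
{ auto_derive; [now exists l|].
  replace (Derive (fun x => psi s x) t) with l by (symmetry; now apply is_derive_unique).
  ring. }
assert (G0 : is_derive (fun x => sin (2 * psi s x)) t 0).
{ apply is_derive_ext_loc with (fun _ => 0).
  - destruct (open_locally_t D s t HO H) as [eps He]. exists eps. intros x Hx.
    symmetry. apply congr_half_pi. exact (HM s x (He x Hx)).
  - apply @is_derive_const. }
assert (E : 2 * cos (2 * psi s t) * l = 0)
  by (rewrite <- (is_derive_unique _ _ _ G); exact (is_derive_unique _ _ _ G0)).
assert (l = 0).
{ apply Rmult_eq_reg_l with (2 * cos (2 * psi s t)); [lra|].
  intros E0. assert (E1 : cos (2 * psi s t) = 0) by lra. rewrite E1 in C. lra. }
unfold l in *. lra.
Qed.

(** Serves to exclude the solution [y = 0] in the second case, where it would make [psi] a multiple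
    of pi everywhere. *)
Lemma identically_mod_pi_half_pi (D : R * R -> Prop) (psi : R -> R -> R) :
  identically_mod PI D psi 0 \/ identically_mod PI D psi (PI / 2) ->
  identically_mod (PI / 2) D psi 0.
Proof.
intros [H|H] s t Hst; apply congr_half_pi; rewrite sin_2a; specialize (H s t Hst).
- rewrite (proj1 (congr_pi_0 _) H). ring.
- rewrite (proj1 (congr_pi_half_pi _) H). ring.
Qed.

(** * Assembly of the cases *)

Lemma tan_plus_half_pi (x : R) : tan (x + PI / 2) = - / tan x.
Proof.
unfold tan. rewrite sin_plus, cos_plus, sin_PI2, cos_PI2.
rewrite !Rmult_0_r, !Rmult_1_r, Rplus_0_l, Rminus_0_l, Rinv_div.
unfold Rdiv. rewrite Rinv_opp. ring.
Qed.

Theorem mainTheorem8 :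
  forall (a : R) (k : Qfamily) (e : branch)
         (D : R * R -> Prop) (psi : R -> R -> R),
  0 < a ->
  plane_domain D ->
  (forall s t, D (s, t) -> Qdom a k e s) ->
  first_equation (Q a k e) D psi ->
  (* the alternative, for each value of the parameter t *)
  (forall t,
     (forall s, D (s, t) -> congr_mod (PI / 2) (psi s t) 0) \/
     (forall s, D (s, t) ->
        sin (2 * psi s t) <> 0 /\
        2 * Derive (fun x => psi x t) s / sin (2 * psi s t) = - Q a k e s))
  /\
  (second_equation (Q a k e) D psi ->
   (* first case *)
   (identically_mod (PI / 2) D psi 0 ->
      (identically_mod PI D psi 0 \/ identically_mod PI D psi (PI / 2)) /\
      (identically_mod PI D psi 0 ->
         (forall s t, D (s, t) ->
            is_derive (fun x => ln (Q a k e x)) s (Q a k e s)) /\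
         k = Rational /\ e = Lower) /\
      (identically_mod PI D psi (PI / 2) ->
         (forall s t, D (s, t) ->
            is_derive (fun x => ln (Q a k e x)) s (- Q a k e s)) /\
         k = Rational /\ e = Upper))
   /\
   (* second case, where tan psi is defined *)
   (~ identically_mod (PI / 2) D psi 0 ->
    (forall s t, D (s, t) -> cos (psi s t) <> 0) ->
      (forall P : R -> R,
         (forall s t, D (s, t) -> is_derive P s (Q a k e s)) ->
         exists y : R -> R, forall s t, D (s, t) ->
           tan (psi s t) = exp (- P s) * y t)
      /\
      (exists y : R -> R, forall s t, D (s, t) ->
         tan (psi s t) = sfactor a k e s * y t)
      /\
      (forall y : R -> R,
         (forall s t, D (s, t) -> tan (psi s t) = sfactor a k e s * y t) ->
         (k = Rational -> e = Upper ->
            (forall t, tproj D t -> is_derive y t (- 1)) /\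
            (exists sigma,
               (forall t, tproj D t -> y t = - (t + sigma)) /\
               (forall s t, D (s, t) ->
                  tan (psi s t) = - ((t + sigma) / s))))
         /\
         (k = Rational -> e = Lower ->
            (forall t, tproj D t -> is_derive y t (- ((y t) ^ 2))) /\
            (exists sigma,
               (forall t, tproj D t ->
                  t + sigma <> 0 /\ y t = 1 / (t + sigma)) /\
               (forall s t, D (s, t) -> tan (psi s t) = s / (t + sigma))))
         /\
         (k = Trigonometric -> e = Upper ->
            (forall t, tproj D t ->
               is_derive y t (a / 2 * ((y t) ^ 2 - 1))) /\
            ((exists eta,
                (forall t, tproj D t -> y t = - tanh (a * t / 2 + eta)) /\
                (forall s t, D (s, t) ->
                   tan (psi s t) =
                   tanh (a * t / 2 + eta) * tan ((a * s + PI) / 2)))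
             (* the real solutions with |y| >= 1: eta = -oo, eta = +oo, and
                eta shifted by i pi / 2 *)
             \/ (forall t, tproj D t -> y t = 1)
             \/ (forall t, tproj D t -> y t = - 1)
             \/ (exists eta, forall t, tproj D t ->
                   sinh (a * t / 2 + eta) <> 0 /\
                   y t = - coth (a * t / 2 + eta))))
         /\
         (k = Hyperbolic -> e = Upper ->
            (forall t, tproj D t ->
               is_derive y t (- (a / 2) * (1 + (y t) ^ 2))) /\
            (exists eta,
               (forall t, tproj D t ->
                  cos (a * t / 2 + eta) <> 0 /\
                  y t = - tan (a * t / 2 + eta)) /\
               (exists eta', eta = eta' - PI / 2 /\
                  forall s t, D (s, t) ->
                    sin (a * t / 2 + eta') <> 0 /\
                    tan (psi s t) =
                    cot (a * t / 2 + eta') * coth (a * s / 2)))))))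
  /\
  (
   (* every value of the integration constant gives a solution *)
   (forall sigma t, is_derive (fun x => - (x + sigma)) t (- 1)) /\
   (forall sigma t, t + sigma <> 0 ->
      is_derive (fun x => 1 / (x + sigma)) t (- ((1 / (t + sigma)) ^ 2))) /\
   (forall eta t,
      is_derive (fun x => - tanh (a * x / 2 + eta)) t
        (a / 2 * ((- tanh (a * t / 2 + eta)) ^ 2 - 1))) /\
   (forall eta t, cos (a * t / 2 + eta) <> 0 ->
      is_derive (fun x => - tan (a * x / 2 + eta)) t
        (- (a / 2) * (1 + (- tan (a * t / 2 + eta)) ^ 2)))).
Proof.
intros a k e D psi Ha [[[s0 t0] H0] [HO [Hconv Htconv]]] HQ HF.
assert (HI : forall t, convex_set (fun s => D (s, t))).
{ intros t x1 x2 x H1 H2 Hx. exact (Hconv x1 x2 x t H1 H2 Hx). }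
assert (HJ : convex_set (tproj D)) by exact Htconv.
split; [|split].
- intros t.
  destruct (classic (exists s, D (s, t) /\ sin (2 * psi s t) = 0)) as [[s1 [H1 E1]]|N].
  + left. intros s Hs. apply congr_half_pi.
    apply (first_equation_sin_zero (Q a k e) (fun x => Qlogder a k x * Q a k e x)
             D psi t s1 s); auto.
    intros x Hx. apply Q_derive; auto. exact (HQ x t Hx).
  + right. intros s Hs.
    assert (Z : sin (2 * psi s t) <> 0) by (intros E; apply N; eauto).
    split; auto.
    assert (L : Derive (fun x => psi x t) s = - (1 / 2) * Q a k e s * sin (2 * psi s t))
      by exact (is_derive_unique _ _ _ (HF s t Hs)).
    rewrite L. field; auto.
- intros HS. split.
  + intros HM.
    assert (K := fun s t => half_pi_multiple_second_equation a k e D psi s t Ha HO HQ HS HM).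
    assert (KQ : forall s t, D (s, t) ->
              k = Rational /\ cos (2 * psi s t) = - IZR (sgn e)).
    { intros s t H. destruct (K s t H) as [C L].
      apply (Qlogder_proportional a k e s); auto. exact (HQ s t H). }
    assert (KD : forall s t, D (s, t) ->
              is_derive (fun x => ln (Q a k e x)) s (cos (2 * psi s t) * Q a k e s)).
    { intros s t H. rewrite <- (proj2 (K s t H)). apply ln_Q_derive; eauto. }
    split; [|split].
    (* [KQ] fixes [cos (2 psi)] by the branch alone, -1 for [Upper] and 1 for [Lower], so the same
       alternative holds at every point of [D]. *)
    * destruct e; simpl in KQ.
      -- right. intros s t H. apply congr_pi_half_pi.
         assert (C := proj2 (KQ s t H)). rewrite cos_2a_cos in C. nra.
      -- left. intros s t H. apply congr_pi_0.
         assert (C := proj2 (KQ s t H)). rewrite cos_2a_sin in C. nra.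
    * intros H1.
      assert (C1 : forall s t, D (s, t) -> cos (2 * psi s t) = 1).
      { intros s t H. rewrite cos_2a_sin, (proj1 (congr_pi_0 _) (H1 s t H)). ring. }
      split; [|split].
      -- intros s t H. rewrite <- (Rmult_1_l (Q a k e s)), <- (C1 s t H). auto.
      -- exact (proj1 (KQ s0 t0 H0)).
      -- destruct (KQ s0 t0 H0) as [_ C]. rewrite (C1 s0 t0 H0) in C.
         destruct e; simpl in C; [lra | reflexivity].
    * intros H1.
      assert (C1 : forall s t, D (s, t) -> cos (2 * psi s t) = - 1).
      { intros s t H. rewrite cos_2a_cos, (proj1 (congr_pi_half_pi _) (H1 s t H)). ring. }
      split; [|split].
      -- intros s t H. replace (- Q a k e s) with (- 1 * Q a k e s) by ring.
         rewrite <- (C1 s t H). auto.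
      -- exact (proj1 (KQ s0 t0 H0)).
      -- destruct (KQ s0 t0 H0) as [_ C]. rewrite (C1 s0 t0 H0) in C.
         destruct e; simpl in C; [reflexivity | lra].
  + intros HN Hc. split; [|split].
    * intros P HP.
      apply (tan_factorization (Q a k e) (fun s => exp (- P s))); auto.
      intros s t H. assert (X := exp_pos (- P s)). split; [lra|].
      assert (G := HP s t H). auto_derive; [now exists (Q a k e s)|].
      replace (Derive (fun x => P x) s) with (Q a k e s)
        by (symmetry; now apply is_derive_unique).
      ring.
    * apply (tan_factorization (Q a k e) (sfactor a k e)); auto.
      intros s t H. apply sfactor_derive; eauto.
    * intros y Hy.
      assert (DY := fun s t => tan_factor_derive a k e D psi y s t Ha HO HQ HS Hc Hy).
      split; [|split; [|split]]; intros -> ->.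
      -- assert (ODE : forall t, tproj D t -> is_derive y t (- 1)).
         (* Any [s] in the section over [t] will do, as the right-hand side no longer depends on
            it. *)
         { intros t [s H]. rewrite <- (y_ode_rational_upper a s (y t)); eauto. }
         split; auto.
         destruct (integrate_constant_slope (tproj D) y (- 1) HJ ODE) as [c Hy'].
         exists (- c).
         assert (Y : forall t, tproj D t -> y t = - (t + - c))
           by (intros t Ht; rewrite (Hy' t Ht); ring).
         split; auto.
         intros s t H. rewrite (Hy s t H), (Y t) by now exists s.
         destruct (HQ s t H) as [H1 _]. simpl in *. field. lra.
      -- assert (ODE : forall t, tproj D t -> is_derive y t (- (y t) ^ 2)).
         { intros t [s H]. rewrite <- (y_ode_rational_lower a s (y t)); eauto. }
         split; auto.
         destruct (integrate_minus_square (tproj D) y HJ ODE) as [Y|[c Y]].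
         (* With [y = 0], [tan psi] vanishes on all of [D], which is the first case, excluded by
            [HN]. *)
         { exfalso. apply HN, identically_mod_pi_half_pi. left. intros s t H.
           apply congr_pi_0.
           assert (T := Hy s t H). rewrite (Y t) in T by now exists s.
           assert (C := Hc s t H). unfold tan in T. rewrite Rmult_0_r in T.
           apply Rmult_eq_reg_r with (/ cos (psi s t));
             [lra | now apply Rinv_neq_0_compat]. }
         exists c. split; auto.
         intros s t H. rewrite (Hy s t H).
         destruct (Y t) as [N0 E]; [now exists s|]. rewrite E. simpl. field; auto.
      -- assert (ODE : forall t, tproj D t -> is_derive y t (a / 2 * ((y t) ^ 2 - 1))).
         { intros t [s H]. rewrite <- (y_ode_trigonometric_upper a s (y t)); eauto. }
         split; auto.
         destruct (integrate_square_minus_one (tproj D) y a HJ ODE) as [[eta Y]|Y];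
           [left | now right].
         exists eta. split; auto.
         intros s t H. rewrite (Hy s t H), (Y t) by now exists s.
         (* The quarter-period shift absorbs both the reciprocal in [sfactor] and the minus sign of
            [y]. *)
         replace ((a * s + PI) / 2) with (a * s / 2 + PI / 2) by field.
         rewrite tan_plus_half_pi. simpl. rewrite Rmult_1_r. ring.
      -- assert (ODE : forall t, tproj D t ->
                   is_derive y t (- (a / 2) * (1 + (y t) ^ 2))).
         { intros t [s H]. rewrite <- (y_ode_hyperbolic_upper a s (y t)); eauto. }
         split; auto.
         destruct (integrate_minus_one_plus_square (tproj D) y a HJ ODE) as [eta Y].
         exists eta. split; auto.
         (* With this shift [- tan x = cot (x + pi/2)], and the nonvanishing [cos x] becomes the
            denominator [sin (x + pi/2)]. *)
         exists (eta + PI / 2). split; [ring|].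
         intros s t H. destruct (Y t) as [C E]; [now exists s|].
         replace (a * t / 2 + (eta + PI / 2)) with (a * t / 2 + eta + PI / 2) by ring.
         set (x := a * t / 2 + eta) in *.
         unfold cot. rewrite sin_plus, cos_plus, sin_PI2, cos_PI2.
         rewrite !Rmult_0_r, !Rmult_1_r, !Rplus_0_l. split; [exact C|].
         rewrite (Hy s t H), E. simpl. unfold tan, tanh, coth.
         assert (H1 := Qdom_hyp_half a Upper s Ha (HQ s t H)). simpl in H1.
         assert (H2 := cosh_pos (a * s / 2)).
         field. repeat split; auto; lra.
- split; [|split; [|split]].
  + intros sigma t. auto_derive; auto.
  + intros sigma t H. auto_derive; auto. field; auto.
  + intros eta t.
    assert (T : is_derive (fun x => tanh (a * x / 2 + eta)) t
                  (scal (a / 2) (1 - tanh (a * t / 2 + eta) ^ 2))).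
    { apply (is_derive_comp tanh (fun x => a * x / 2 + eta)); [apply is_derive_tanh|].
      auto_derive; auto. field. }
    replace (a / 2 * ((- tanh (a * t / 2 + eta)) ^ 2 - 1))
      with (- (a / 2 * (1 - tanh (a * t / 2 + eta) ^ 2))) by ring.
    exact (is_derive_opp _ _ _ T).
  + intros eta t H.
    assert (T := tan_comp_derive (fun x => a * x / 2 + eta) t (a / 2) H).
    replace (- (a / 2) * (1 + (- tan (a * t / 2 + eta)) ^ 2))
      with (- ((1 + tan (a * t / 2 + eta) ^ 2) * (a / 2))) by ring.
    apply (@is_derive_opp R_AbsRing R_NormedModule), T. auto_derive; auto. field.
Qed.
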